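(* Let $n\ge 2$, let $\Omega\subset\mathbb{R}^n$ be open and bounded, let $d={\rm diam}(\Omega)$, let $f\in\mathcal{C}(\Omega)$ and $u\in\mathcal{C}(\overline\Omega)$. (i) If $-\Delta_\infty u\le f(x)$ in $\Omega$ in the viscosity sense, then $$\big(\sup_{\Omega}u^{+}-\sup_{\partial\Omega}u^{+}\big)^4\le 4\,d^4\int_{\sup_{\partial\Omega}u^{+}}^{\sup_{\Omega}u^{+}}\big\|f^{+}\cdot 1_{C^{+}(u)}\big\|_{L^\infty(\{u^{+}=r\})}\,dr .$$ (ii) If $-\Delta_\infty u\ge f(x)$ in $\Omega$ in the viscosity sense, then $$\big(\sup_{\Omega}u^{-}-\sup_{\partial\Omega}u^{-}\big)^4\le 4\,d^4\int_{\sup_{\partial\Omega}u^{-}}^{\sup_{\Omega}u^{-}}\big\|f^{-}\cdot 1_{C^{+}(-u)}\big\|_{L^\infty(\{u^{-}=r\})}\,dr .$$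
   Context: Notation: $a^+=\max\{0,a\}$, $a^-=\max\{0,-a\}$; $1_A$ is the indicator function of $A$. The (non-normalized) infinity Laplacian is $\Delta_\infty\varphi=\langle D^2\varphi\,\nabla\varphi,\nabla\varphi\rangle$. Viscosity sense: an upper semicontinuous $u:\Omega\to\mathbb{R}$ satisfies $-\Delta_\infty u\le f$ in $\Omega$ if for all $x_0\in\Omega$ and $\varphi\in\mathcal{C}^2(\Omega)$ such that $u-\varphi$ has a local maximum at $x_0$ one has $-\Delta_\infty\varphi(x_0)\le f(x_0)$; a lower semicontinuous $u$ satisfies $-\Delta_\infty u\ge f$ in $\Omega$ if for all $x_0\in\Omega$ and $\varphi\in\mathcal{C}^2(\Omega)$ such that $u-\varphi$ has a local minimum at $x_0$ one has $-\Delta_\infty\varphi(x_0)\ge f(x_0)$. Concave envelope and upper contact set: for $w\in\mathcal{C}(\overline\Omega)$ and $x\in\Omega$, $\Gamma(w)(x)=\inf\{L(x): L \text{ affine},\ L\ge w \text{ in }\Omega\}$ and $C^+(w)=\{x\in\Omega: w(x)=\Gamma(w)(x)\}$. $\|g\|_{L^\infty(\{u^\pm=r\})}$ denotes the (pointwise) supremum of $|g|$ over the level set $\{x\in\Omega:u^\pm(x)=r\}$. The right-hand sides may be $+\infty$. *)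

(* Defs.v *)
From HB Require Import structures.
From mathcomp Require Import all_boot all_order all_algebra.
From mathcomp Require Import all_classical all_reals all_analysis.

Set Implicit Arguments.
Unset Strict Implicit.
Unset Printing Implicit Defensive.

Import Order.TTheory GRing.Theory Num.Theory numFieldNormedType.Exports.

Local Open Scope classical_set_scope.
Local Open Scope ring_scope.

(* The norm of 'rV[R]_n in the library is the sup norm, which induces the usual
   topology and bounded sets; metric quantities use the Euclidean norm below. *)
Definition inner (R : realType) (n : nat) (x y : 'rV[R]_n) : R :=
  \sum_i x 0 i * y 0 i.

Definition enorm (R : realType) (n : nat) (x : 'rV[R]_n) : R :=
  Num.sqrt (inner x x).

Definition diam (R : realType) (n : nat) (A : set 'rV[R]_n) : R :=
  sup [set enorm (x - y) | x in A & y in A].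

Definition boundary (T : topologicalType) (A : set T) : set T :=
  closure A `\` A°.

Definition partial (R : realType) (n : nat) (i : 'I_n) (phi : 'rV[R]_n -> R)
    (x : 'rV[R]_n) : R :=
  'D_(delta_mx 0 i) phi x.

(* The classes C^1 and C^2 are only meant for an open set Omega; the values
   outside Omega are irrelevant. *)
Definition C1 (R : realType) (n : nat) (Omega : set 'rV[R]_n)
    (phi : 'rV[R]_n -> R) : Prop :=
  forall i : 'I_n,
    (forall x, Omega x -> derivable phi x (delta_mx 0 i)) /\
    {within Omega, continuous (partial i phi)}.

Definition C2 (R : realType) (n : nat) (Omega : set 'rV[R]_n)
    (phi : 'rV[R]_n -> R) : Prop :=
  C1 Omega phi /\ forall i : 'I_n, C1 Omega (partial i phi).

Definition gradient (R : realType) (n : nat) (phi : 'rV[R]_n -> R)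
    (x : 'rV[R]_n) : 'rV[R]_n :=
  \row_i partial i phi x.

Definition hessian (R : realType) (n : nat) (phi : 'rV[R]_n -> R)
    (x : 'rV[R]_n) : 'M[R]_n :=
  \matrix_(i, j) partial j (partial i phi) x.

(* Vectors are rows, so the vector (D^2 phi)(grad phi) is grad phi *m H^T. *)
Definition inf_laplacian (R : realType) (n : nat) (phi : 'rV[R]_n -> R)
    (x : 'rV[R]_n) : R :=
  inner (gradient phi x *m (hessian phi x)^T) (gradient phi x).

Definition usc_on (R : realType) (T : topologicalType) (A : set T)
    (u : T -> R) : Prop :=
  forall x, A x -> forall a, u x < a -> \forall y \near x, A y -> u y < a.

Definition lsc_on (R : realType) (T : topologicalType) (A : set T)
    (u : T -> R) : Prop :=
  forall x, A x -> forall a, a < u x -> \forall y \near x, A y -> a < u y.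

Definition viscosity_subsolution (R : realType) (n : nat)
    (Omega : set 'rV[R]_n) (u f : 'rV[R]_n -> R) : Prop :=
  usc_on Omega u /\
  forall (x0 : 'rV[R]_n) (phi : 'rV[R]_n -> R),
    Omega x0 -> C2 Omega phi ->
    (\forall x \near x0, Omega x -> u x - phi x <= u x0 - phi x0) ->
    - inf_laplacian phi x0 <= f x0.

Definition viscosity_supersolution (R : realType) (n : nat)
    (Omega : set 'rV[R]_n) (u f : 'rV[R]_n -> R) : Prop :=
  lsc_on Omega u /\
  forall (x0 : 'rV[R]_n) (phi : 'rV[R]_n -> R),
    Omega x0 -> C2 Omega phi ->
    (\forall x \near x0, Omega x -> u x0 - phi x0 <= u x - phi x) ->
    f x0 <= - inf_laplacian phi x0.

Definition affine_fun (R : realType) (n : nat) (L : 'rV[R]_n -> R) : Prop :=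
  exists (p : 'rV[R]_n) (b : R), forall x, L x = inner p x + b.

(* The infimum is that of a nonempty set bounded below as soon as w is bounded
   above on Omega and x is in Omega. *)
Definition concave_envelope (R : realType) (n : nat) (Omega : set 'rV[R]_n)
    (w : 'rV[R]_n -> R) (x : 'rV[R]_n) : R :=
  inf [set L x | L in
    [set L : 'rV[R]_n -> R |
      affine_fun L /\ forall y, Omega y -> w y <= L y]].

Definition contact_set (R : realType) (n : nat) (Omega : set 'rV[R]_n)
    (w : 'rV[R]_n -> R) : set 'rV[R]_n :=
  [set x | Omega x /\ w x = concave_envelope Omega w x].

(* Supremum of |g| over A in [0, +oo]; adding 0 only matters for A empty. *)
Definition sup_norm_on (R : realType) (T : Type) (A : set T) (g : T -> R) :
    \bar R :=
  ereal_sup (0%E |` [set `|g x|%:E | x in A]).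

(* Main.v *)
Require Import Defs.
From HB Require Import structures.
From mathcomp Require Import all_boot all_order all_algebra.
From mathcomp Require Import all_classical all_reals all_analysis.
From mathcomp Require Import measurable_realfun ring lra.

Import Order.TTheory GRing.Theory Num.Theory numFieldNormedType.Exports.

Local Open Scope classical_set_scope.
Local Open Scope ring_scope.

(* The estimate is one-dimensional: only slopes along a fixed coordinate x_i
   are used.  Let M be the maximum of u, m the maximum of u^+ on the boundary
   and d the diameter, and suppose that the integral of g, the supremum of f^+
   on the contact points at a given level, is below T^4/4 for some
   T < (M - m)/d.  Approximate g from above by a lower semicontinuous G > g
   whose integral is still below T^4/4, let
   P(r)^4 = T^4 - 4 * (integral of G up to r) and let H be convex with
   H' = 1/P.  (The inverse h of H solves - h'' h'^2 = G(h).)  Let y maximize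
   H(u x) - x_i on the closure of Omega.  As H' >= 1/T one gets u(y) >= M - T d > m, so y is an
   interior point; by convexity of H it is a contact point, with slope P(u y);
   and the strict convexity of H bounds u from above near y by a quadratic
   polynomial in x_i whose infinity Laplacian at y is < - f(y). *)

(** * Lower integrals, relative continuity and compactness *)

(* The library integral of a nonnegative function is a supremum over simple
   functions, hence monotone even on functions that, like the level-set
   supremum of the theorem, are not known to be measurable. *)
Lemma ge0_le_lower_integral (d : measure_display) (T : measurableType d)
    (R : realType) (mu : {measure set T -> \bar R}) (D1 D2 : set T)
    (f1 f2 : T -> \bar R) :
  (forall x, D1 x -> 0 <= f1 x)%E -> (forall x, D2 x -> 0 <= f2 x)%E ->
  (forall x, (f1 \_ D1) x <= (f2 \_ D2) x)%E ->
  (\int[mu]_(x in D1) f1 x <= \int[mu]_(x in D2) f2 x)%E.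
Proof.
move=> f10 f20 f12; rewrite (integral_mkcond D1) (integral_mkcond D2).
rewrite !ge0_integralTE; last 2 first.
- by move=> x; apply: erestrict_ge0.
- by move=> x; apply: erestrict_ge0.
apply: ge_ereal_sup => _ [h /= hf <-]; apply: ereal_sup_ubound; exists h => //=.
by move=> x; apply: le_trans (f12 x).
Qed.

Lemma within_continuous_near (R : realType) (X : topologicalType) (E : set X)
    (f : X -> R) x e : {within E, continuous f} -> E x -> 0 < e ->
  \forall y \near x, E y -> `|f x - f y| < e.
Proof.
move=> /subspace_continuousP cf Ex e0.
by have /cvgrPdist_lt/(_ _ e0) := cf _ Ex; rewrite near_withinE.
Qed.

(** The hypothesis is closedness of [Q] relative to [A]: near a point of [A] outside [Q] the
    covering condition holds vacuously. *)
Lemma compact_rel_closed (X : topologicalType) (A Q : set X) :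
  compact A -> (forall x, A x -> ~ Q x -> \forall y \near x, A y -> ~ Q y) ->
  compact (A `&` Q).
Proof.
move=> cA AQ; apply/compact_near_coveringP => I F P FF AP.
suff : \forall i \near F, A `<=` (fun x => Q x -> P i x).
  by apply: filterS => i AQP x [Ax Qx]; exact: AQP.
move/compact_near_coveringP/near_covering_withinP: cA; apply => x Ax.
have [Qx|nQx] := pselect (Q x).
  by have := AP x (conj Ax Qx); apply: filterS => -[y i] /= Py _ _.
exists ([set y | A y -> ~ Q y], setT) => /=.
  by split; [exact: AQ|exact: filterT].
by move=> -[y i] /= [AnQ _] Ay Qy; case: (AnQ Ay Qy).
Qed.

(** * Suprema over level sets and their majorants *)

(* 0 when [A] is empty; beware of the junk value 0 when [phi] is unbounded. *)
Definition nnsup {R : realType} {X : Type} (phi : X -> R) (A : set X) : R :=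
  sup (0 |` phi @` A).

Section nnsup.
Context {R : realType} {X : Type}.
Variables (phi : X -> R) (b : R).

Let hs (A : set X) : (forall x, A x -> phi x <= b) -> has_sup (0 |` phi @` A).
Proof.
move=> Ab; split; first by exists 0; left.
by exists (Num.max 0 b) => _ [->|[x Ax <-]]; rewrite le_max ?lexx// Ab ?orbT.
Qed.

Lemma nnsup_ge0 (A : set X) : 0 <= nnsup phi A.
Proof.
have [[_ Ab]|nA] := pselect (has_sup (0 |` phi @` A)).
  by apply: ub_le_sup => //; left.
by rewrite /nnsup sup_out.
Qed.

Lemma nnsup_ub (A : set X) x :
  (forall x, A x -> phi x <= b) -> A x -> phi x <= nnsup phi A.
Proof.
by move=> /hs Ab Ax; apply: ub_le_sup; [exact: Ab.2|right; exists x].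
Qed.

Lemma nnsup_le (A : set X) c :
  0 <= c -> (forall x, A x -> phi x <= c) -> nnsup phi A <= c.
Proof.
move=> c0 Ac; apply: ge_sup; first by exists 0; left.
by move=> _ [->//|[x Ax <-]]; exact: Ac.
Qed.

Lemma nnsup_gt (A : set X) c : (forall x, A x -> phi x <= b) -> 0 <= c ->
  c < nnsup phi A -> exists2 x, A x & c < phi x.
Proof.
move=> Ab c0 /sup_gt[]; first by exists 0; left.
by move=> _ [->|[x Ax <-] ?]; [rewrite ltNge c0|exists x].
Qed.

End nnsup.

(** Near a point of the level, [phi] is below the level supremum plus [e] by continuity; a point off
    the level has a neighbourhood that misses all sufficiently thin bands. Compactness of [E] makes
    one [n] serve everywhere. *)
Lemma nnsup_near_level_cvg (R : realType) (X : topologicalType) (E : set X)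
    (v phi : X -> R) (b : R) :
  compact E -> {within E, continuous v} -> {within E, continuous phi} ->
  (forall x, E x -> phi x <= b) -> forall r,
  nnsup phi (E `&` [set x | `|v x - r| < n.+1%:R^-1]) @[n --> \oo] -->
    nnsup phi (E `&` [set x | v x = r]).
Proof.
move=> cE cv cphi Eb r.
have Eb' A : forall x, (E `&` A) x -> phi x <= b by move=> x [/Eb].
set g := (X in _ --> X).
apply/cvgrPdist_le => e e0.
have gn : \forall n \near \oo, E `<=`
    (fun x => `|v x - r| < n.+1%:R^-1 -> phi x <= g + e).
  move/compact_near_coveringP/near_covering_withinP: (cE); apply => x Ex.
  have [vxr|/eqP vxr] := pselect (v x = r).
    exists ([set y | E y -> phi y <= g + e], setT) => /=.
      split; last exact: filterT.
      have := within_continuous_near _ _ _ _ _ _ cphi Ex e0.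
      apply: filterS => y /[apply].
      have : phi x <= g by exact: (nnsup_ub phi b _ _ (Eb' _) (conj Ex vxr)).
      by rewrite ltr_norml => + /andP[]; lra.
    by move=> -[y n] /= [Ay _] /Ay.
  have d0 : 0 < `|v x - r| / 2 by rewrite divr_gt0// normr_gt0 subr_eq0.
  exists ([set y | E y -> `|v x - v y| < `|v x - r| / 2],
          [set n | n.+1%:R^-1 < `|v x - r| / 2]) => /=.
    split; last exact: near_infty_natSinv_lt (PosNum d0).
    exact: (within_continuous_near _ _ _ _ _ _ cv Ex d0).
  move=> -[y n] /= [vxy nd] Ey vyr; exfalso.
  have := ler_distD (v y) (v x) r; have := vxy Ey.
  by have := lt_trans vyr nd; lra.
apply: filterS gn => n gn.
have gle : g <= nnsup phi (E `&` [set x | `|v x - r| < n.+1%:R^-1]).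
  apply: nnsup_le => [|x [Ex vxr]]; first exact: nnsup_ge0.
  by apply: (nnsup_ub phi b _ _ (Eb' _)); split => //=; rewrite vxr subrr normr0.
rewrite distrC ger0_norm ?subr_ge0// lerBlDl; apply: nnsup_le.
  by apply: addr_ge0; [exact: nnsup_ge0|exact: ltW].
by move=> x [Ex /= vxr]; exact: gn.
Qed.

(** The band condition is open in [r], so a near-maximal point for [r] still counts for nearby
    levels. This gives lower semicontinuity, hence measurability. *)
Lemma measurable_nnsup_near_level (R : realType) (X : Type) (E : set X)
    (v phi : X -> R) (b e : R) : (forall x, E x -> phi x <= b) ->
  measurable_fun [set: R]
    (fun r => nnsup phi (E `&` [set x | `|v x - r| < e])).
Proof.
move=> Eb; have Eb' A : forall x, (E `&` A) x -> phi x <= b by move=> x [/Eb].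
apply/measurable_EFinP. apply: lower_semicontinuous_measurable => r a /=.
rewrite lte_fin => ag; have [a0|a0] := ltP a 0.
  exists setT; first exact: filterT.
  by move=> s _; rewrite lte_fin; apply: lt_le_trans a0 _; exact: nnsup_ge0.
have [x [Ex vxr] ax] := nnsup_gt phi b _ _ (Eb' _) a0 ag.
exists [set s | `|v x - s| < e].
  have e0 : 0 < e - `|v x - r| by rewrite subr_gt0.
  exists (e - `|v x - r|) => //= s; rewrite /ball/= => rs.
  by have := ler_distD r (v x) s; lra.
move=> s vxs; rewrite lte_fin; apply: lt_le_trans ax _.
exact: (nnsup_ub phi b _ _ (Eb' _)).
Qed.

(** Suprema over thin bands tend to the level suprema, so by dominated convergence one of them still
    has integral below [c]; a small constant added to it provides a strict margin. In the last
    clause [e] is both this margin and the width of the window of levels. *)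
Lemma nnsup_level_majorant (R : realType) (X : topologicalType) (E : set X)
    (v phi : X -> R) (b a1 a2 c : R) :
  compact E -> {within E, continuous v} -> {within E, continuous phi} ->
  (forall x, E x -> phi x <= b) -> a1 < a2 ->
  (\int[lebesgue_measure]_(r in `[a1, a2])
     (nnsup phi (E `&` [set x | v x = r]))%:E < c%:E)%E ->
  exists G : R -> R, [/\ measurable_fun setT G, exists B, forall r, 0 <= G r <= B,
    (\int[lebesgue_measure]_(r in `[a1, a2]) (G r)%:E < c%:E)%E &
    forall x, E x -> exists2 e, 0 < e &
      forall r, `|v x - r| < e -> phi x + e <= G r].
Proof.
move=> cE cv cphi Eb a12 gc.
have Eb' A : forall x, (E `&` A) x -> phi x <= b by move=> x [/Eb].
pose g n r := nnsup phi (E `&` [set x | `|v x - r| < n.+1%:R^-1]).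
have mg n : measurable_fun setT (g n).
  exact: (measurable_nnsup_near_level _ _ _ _ _ _ _ Eb).
have gb n r : 0 <= g n r <= Num.max 0 b.
  rewrite nnsup_ge0/=; apply: nnsup_le.
    by rewrite le_max lexx.
  by move=> x [/Eb xb _]; rewrite le_max xb orbT.
pose g0 r := (nnsup phi (E `&` [set x | v x = r]))%:E.
rewrite -/g0 in gc.
have gg0 r : g n r @[n --> \oo] --> nnsup phi (E `&` [set x | v x = r]).
  exact: (nnsup_near_level_cvg _ _ _ _ _ b).
have iB : lebesgue_measure.-integrable `[a1, a2] (EFin \o (fun=> Num.max 0 b : R)).
  apply: continuous_compact_integrable; first exact: segment_compact.
  by move=> x; exact: cvg_cst.
have [] := @dominated_convergence _ _ _ (@lebesgue_measure R) `[a1, a2]%classic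
  ltac:(by []) (fun n r => (g n r)%:E) g0 _ _ _ _ iB _.
- by move=> n; apply/measurable_EFinP; exact: (measurable_funTS (mg n)).
- apply: (@emeasurable_fun_cvg _ _ _ _ (fun n r => (g n r)%:E)).
    by move=> n; apply/measurable_EFinP; exact: (measurable_funTS (mg n)).
  by move=> r _; apply: cvg_EFin; [exact: nearW|exact: gg0].
- by apply: aeW => r _; apply: cvg_EFin; [exact: nearW|exact: gg0].
- by apply: aeW => r n _; rewrite lee_fin ger0_norm; have /andP[] := gb n r.
move=> ig0 _ gcvg.
have [l gl] : exists l : R, (\int[lebesgue_measure]_(r in `[a1, a2]) g0 r = l%:E)%E.
  exists (fine (\int[lebesgue_measure]_(r in `[a1, a2]) g0 r)%E).
  by rewrite fineK//; exact: integrable_fin_num.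
rewrite gl lte_fin in gc; rewrite gl in gcvg.
pose m := (l + c) / 2.
have lm : (l%:E < m%:E)%E by rewrite lte_fin /m; lra.
have [n _ /(_ n (leqnn n))/= gnm] := gcvg _ (open_ereal_lt' lm).
(* The divisor exceeds the length of the interval, so the constant [d] adds at most [c - m] to the
   integral. *)
pose d := (c - m) / (a2 - a1 + 1).
have d0 : 0 < d by rewrite divr_gt0// /m; lra.
exists (fun r => g n r + d); split.
- by apply: measurable_funD => //; exact: mg.
- exists (Num.max 0 b + d) => r; have /andP[g1 g2] := gb n r.
  by rewrite lerD2r g2 addr_ge0// ltW.
- under eq_integral do rewrite EFinD.
  rewrite ge0_integralD//=; last 3 first.
  + by move=> r _; rewrite lee_fin; have /andP[] := gb n r.
  + by apply/measurable_EFinP; exact: (measurable_funTS (mg n)).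
  + by move=> r _; rewrite lee_fin ltW.
  rewrite integral_cst//= lebesgue_measure_itv/= lte_fin a12 -EFinD -EFinM.
  have -> : c%:E = (m%:E + (c - m)%:E)%E by rewrite -EFinD subrKC.
  apply: lte_leD => //; rewrite lee_fin /d mulrAC ler_pdivrMr; last by lra.
  by rewrite ler_wpM2l//; [rewrite /m|]; lra.
- move=> x Ex; exists (Num.min d n.+1%:R^-1); first by rewrite lt_min d0/=.
  move=> r; rewrite lt_min => /andP[_ vxr]; apply: lerD.
    exact: (nnsup_ub phi b _ _ (Eb' _)).
  by rewrite ge_min lexx.
Qed.

(** * One-dimensional analysis: the convex profile *)

(** [F r] integrates [G] over the part of [[a1, a2]] to the left of [r]. The truncation keeps [F]
    below [c] on the whole line; in return, the lower bound on increments is claimed inside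
    [[a1, a2]] only. *)
Lemma bounded_primitive (R : realType) (G : R -> R) (a1 a2 b c : R) :
  measurable_fun setT G -> (forall r, 0 <= G r <= b) ->
  (\int[lebesgue_measure]_(r in `[a1, a2]) (G r)%:E < c%:E)%E ->
  exists F : R -> R, [/\ forall r, 0 <= F r < c,
    forall r s, r <= s -> 0 <= F s - F r <= b * (s - r) &
    forall g r s, a1 <= r -> r <= s -> s <= a2 ->
      (forall t, r < t <= s -> g <= G t) -> g * (s - r) <= F s - F r].
Proof.
move=> mG Gb Gc.
pose mu : {measure set (measurableTypeR R) -> \bar R} := lebesgue_measure.
have ib (D : set R) : measurable D -> D `<=` `[a1, a2] ->
    mu.-integrable D (EFin \o G).
  move=> mD Dab.
  apply: (@integrableS _ _ _ mu `[a1, a2]%classic) => //.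
  apply: measurable_bounded_integrable => //.
  - by rewrite /mu/= lebesgue_measure_itv/=; case: ifP; rewrite ?ltry// -EFinB ltry.
  - exact: measurable_funTS.
  - exists b; split; first exact: num_real.
    move=> x bx r _; have /andP[g0 gb] := Gb r.
    by rewrite /= ger0_norm// (le_trans gb)// ltW.
have muI r s : r <= s -> fine (mu `]r, s]%classic) = s - r.
  rewrite /mu/= lebesgue_measure_itv/= lte_fin; case: ltP => //= rs sr.
  by apply/eqP; rewrite eq_sym subr_eq0 eq_le rs sr.
have icst e r s : mu.-integrable `]r, s]%classic (EFin \o (fun=> e : R)).
  apply: (@integrableS _ _ _ mu `[r, s]%classic) => //.
    exact: subset_itv_oc_cc.
  apply: continuous_compact_integrable; first exact: segment_compact.
  by move=> x; exact: cvg_cst.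
have b0 : 0 <= b by have /andP[/le_trans] := Gb 0; exact.
pose D (r : R) : set R := `[a1, a2] `&` `]-oo, r].
have mD r : measurable (D r) by exact: measurableI.
pose F r := \int[mu]_(x in D r) G x.
pose DD (r s : R) : set R := `[a1, a2] `&` `]r, s].
have mDD r s : measurable (DD r s) by exact: measurableI.
have FB r s : r <= s -> F s - F r = \int[mu]_(x in DD r s) G x.
  move=> rs; have -> : F s = F r + \int[mu]_(x in DD r s) G x.
    rewrite -Rintegral_setU//; [|exact: mD|exact: mDD| |]; last 2 first.
    - by apply: ib; [exact: measurableU|rewrite subUset; split => ? []].
    - apply/disj_setPS => x [] [_ /=]; rewrite in_itv/= => xr [_ /=].
      by rewrite in_itv/= ltNge xr.
    rewrite /F; congr Rintegral; rewrite -setIUr; congr (_ `&` _).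
    by rewrite -itv_bndbnd_setU.
  by rewrite addrC addKr.
exists F; split.
- move=> r; rewrite Rintegral_ge0/=; last by move=> x _; have /andP[] := Gb x.
  rewrite -lte_fin /F /Rintegral fineK; last first.
    by apply: integrable_fin_num; [exact: mD|apply: ib; [exact: mD|move=> ? []]].
  apply: le_lt_trans Gc; apply: ge0_subset_integral => //; first exact: mD.
  + by apply/measurable_EFinP; exact: (measurable_funTS mG).
  + by move=> x _; rewrite lee_fin; have /andP[] := Gb x.
  + by move=> ? [].
- move=> r s rs; rewrite FB// Rintegral_ge0/=; last first.
    by move=> x _; have /andP[] := Gb x.
  have -> : b * (s - r) = \int[mu]_(x in `]r, s]) b.
    by rewrite Rintegral_cst// muI.
  have -> : DD r s = `]r, s] `&` `[a1, a2] by rewrite /DD setIC.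
  rewrite Rintegral_mkcondr.
  apply: le_Rintegral => //.
  - rewrite -restrict_EFin; apply/integrable_restrict => //; rewrite setIC.
    by apply: ib; [exact: mDD|move=> ? []].
  - move=> x _; rewrite patchE; case: ifP => _; last exact: b0.
    by have /andP[] := Gb x.
- move=> g r s ar rs sa gG; rewrite FB//.
  have -> : DD r s = `]r, s]%classic.
    rewrite /DD setIidr//; apply: subset_itv; rewrite bnd_simp//.
  have -> : g * (s - r) = \int[mu]_(x in `]r, s]) g.
    by rewrite Rintegral_cst// muI.
  apply: le_Rintegral => //.
  by apply: ib => //; apply: subset_itv; rewrite bnd_simp.
Qed.

(** Subtracting the quadratic polynomial from [H] leaves a function [D] whose derivative has the
    sign of [t - r], so [D r <= D s] by the mean value theorem. Used with [k = 0] for supporting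
    lines and with [k = g' / P r ^+ 5] for quadratic growth. *)
Lemma le_increment_of_derive (R : realType) (H K : R -> R) (lo a k r s : R) :
  (forall t, lo < t -> is_derive t 1 H (K t)) -> lo < r -> lo < s ->
  (forall t, Num.min r s < t < Num.max r s ->
    0 <= (K t - a - k * (t - r)) * (t - r)) ->
  a * (s - r) + k / 2 * (s - r) ^+ 2 <= H s - H r.
Proof.
move=> dH lor los Kt.
pose D : R -> R := H - (a \*: (id - cst r)) - ((k / 2) \*: ((id - cst r) ^+ 2)).
have DE t : D t = H t - a * (t - r) - k / 2 * (t - r) ^+ 2 by [].
have dD t : lo < t -> is_derive t 1 D (K t - a - k * (t - r)).
  move=> /dH dHt; rewrite /D; apply: is_derive_eq.
  rewrite /GRing.scale/=.
  have -> : (id - cst r : R -> R) t = t - r by [].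
  by field.
suff : D r <= D s by rewrite !DE subrr; lra.
have cD t : lo < t -> {for t, continuous D}.
  by move=> /dD[+ _]; rewrite derivable1_diffP => /differentiable_continuous; exact.
have [rs|sr|->//] := ltgtP r s.
- have [||c crs Dc] := @MVT _ D (fun t => K t - a - k * (t - r)) r s rs.
  + by move=> t; rewrite in_itv/= => /andP[rt _]; apply: dD; apply: lt_trans rt.
  + apply: continuous_in_subspaceT => t; rewrite inE/= in_itv/= => /andP[rt _].
    by apply: cD; apply: lt_le_trans rt.
  move: crs; rewrite in_itv/= => /andP[rc cs].
  have := Kt c; rewrite (min_l (ltW rs)) (max_r (ltW rs)) rc cs => /(_ isT).
  rewrite pmulr_lge0 ?subr_gt0// => Dc0.
  by rewrite -subr_ge0 Dc mulr_ge0// subr_ge0 ltW.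
- have [||c crs Dc] := @MVT _ D (fun t => K t - a - k * (t - r)) s r sr.
  + by move=> t; rewrite in_itv/= => /andP[rt _]; apply: dD; apply: lt_trans rt.
  + apply: continuous_in_subspaceT => t; rewrite inE/= in_itv/= => /andP[rt _].
    by apply: cD; apply: lt_le_trans rt.
  move: crs; rewrite in_itv/= => /andP[sc cr].
  have := Kt c; rewrite (min_r (ltW sr)) (max_l (ltW sr)) sc cr => /(_ isT).
  rewrite nmulr_lge0 ?subr_lt0// => Dc0.
  by rewrite -subr_ge0 -opprB Dc oppr_ge0 mulr_le0_ge0// subr_ge0 ltW.
Qed.

(** Factoring gives [q^4 - p^4 <= 4 q^3 (q - p)]. This converts increments of [F], hence of [P^4],
    into increments of [1 / P]. *)
Lemma le_inv_sub (R : realType) (p q d : R) : 0 < p -> p <= q ->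
  4 * d <= q ^+ 4 - p ^+ 4 -> d / (q ^+ 4 * p) <= p^-1 - q^-1.
Proof.
move=> p0 pq dpq; have q0 : 0 < q by apply: lt_le_trans pq.
have -> : p^-1 - q^-1 = (q - p) * q ^+ 3 / (q ^+ 4 * p).
  by field; rewrite !lt0r_neq0.
rewrite ler_pM2r ?invr_gt0 ?mulr_gt0 ?exprn_gt0//.
apply: le_trans (_ : (q ^+ 4 - p ^+ 4) / 4 <= _); first lra.
have -> : q ^+ 4 - p ^+ 4 = (q - p) * (q ^+ 3 + q ^+ 2 * p + q * p ^+ 2 + p ^+ 3).
  by ring.
rewrite -mulrA ler_wpM2l ?subr_ge0// ler_pdivrMr//.
have pn n : p ^+ n <= q ^+ n by rewrite lerXn2r// nnegrE ltW.
have h1 : q ^+ 2 * p <= q ^+ 3 by rewrite (exprSr q 2) ler_wpM2l ?exprn_ge0// ltW.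
have h2 : q * p ^+ 2 <= q ^+ 3 by rewrite (exprS q 2) ler_wpM2l// ltW.
by have := pn 3; lra.
Qed.

(** With [P^4 = T^4 - 4 F] and [H' = K = 1 / P] one has formally [K' = G / P^5], whence the
    coefficient in the last clause. As [G] is only measurable, increments of [K] replace [K'], and
    the loss from [g] to [g'] absorbs the variation of [P] near [r]. [lo] is the base point of the
    integral defining [H]. *)
Lemma convex_profile (R : realType) (G : R -> R) (T b a1 a2 lo : R) :
  0 < T -> measurable_fun setT G -> (forall r, 0 <= G r <= b) ->
  (\int[lebesgue_measure]_(r in `[a1, a2]) (G r)%:E < (T ^+ 4 / 4)%:E)%E ->
  exists H P : R -> R, [/\ forall r, 0 < P r <= T,
    forall r, lo < r -> {for r, continuous H},
    forall r s, lo < r -> lo < s -> (P r)^-1 * (s - r) <= H s - H r &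
    forall g e g' r, 0 < e -> 0 <= g' -> g' < g -> lo < r ->
      a1 <= r - e -> r + e <= a2 ->
      (forall t, `|r - t| < e -> g <= G t) ->
      \forall s \near r,
        (P r)^-1 * (s - r) + g' / P r ^+ 5 / 2 * (s - r) ^+ 2 <= H s - H r].
Proof.
move=> T0 mG Gb GT; have [F [Fc F1 F2]] := bounded_primitive _ _ _ _ _ _ mG Gb GT.
pose P r := Num.sqrt (Num.sqrt (T ^+ 4 - 4 * F r)).
have FT r : 0 < T ^+ 4 - 4 * F r.
  by have /andP[_] := Fc r; rewrite ltr_pdivlMr// subr_gt0 mulrC.
have P4 r : P r ^+ 4 = T ^+ 4 - 4 * F r.
  by rewrite (exprM _ 2 2) !sqr_sqrtr ?sqrtr_ge0// ltW.
have P0 r : 0 < P r by rewrite !sqrtr_gt0.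
have Pn r : P r \in Num.nneg by rewrite nnegrE ltW.
have PT r : P r <= T.
  rewrite -(@ler_pXn2r _ 4)// ?nnegrE ?(ltW T0)// P4.
  by have /andP[? _] := Fc r; lra.
have P_le r s : r <= s -> P s <= P r.
  by move=> /F1/andP[Frs _]; rewrite -(@ler_pXn2r _ 4)// !P4; lra.
pose K r := (P r)^-1.
have Kle r s : r <= s -> K r <= K s.
  by move=> /P_le Prs; rewrite /K lef_pV2 ?posrE.
have b0 : 0 <= b by have /andP[/le_trans] := Gb 0; exact.
have cF : continuous F.
  move=> r; apply/cvgrPdist_lt => e e0.
  have b1 : 0 < b + 1 by rewrite ltr_wpDl.
  exists (e / (b + 1)); first by rewrite /= divr_gt0.
  move=> s /=; rewrite ltr_pdivlMr// => rs.
  have h : `|F r - F s| <= b * `|r - s|.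
    have [rs'|sr] := leP r s.
      have /andP[? ?] := F1 _ _ rs'.
      by rewrite distrC ger0_norm// (distrC r) ger0_norm// subr_ge0.
    have /andP[? ?] := F1 _ _ (ltW sr).
    by rewrite ger0_norm// ger0_norm// subr_ge0 ltW.
  by apply: le_lt_trans h _; have := normr_ge0 (r - s); nra.
have cK : continuous K.
  move=> r; apply: cvgV; first by rewrite gt_eqF.
  apply: (@continuous_comp _ _ _ (fun r => Num.sqrt (T ^+ 4 - 4 * F r)) Num.sqrt).
    apply: (@continuous_comp _ _ _ (fun r => T ^+ 4 - 4 * F r) Num.sqrt).
      by apply: cvgB; [exact: cvg_cst|apply: cvgM; [exact: cvg_cst|exact: cF]].
    exact: sqrt_continuous.
  exact: sqrt_continuous.
pose H r := \int[lebesgue_measure]_(t in `[lo, r]) K t.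
have dH t : lo < t -> is_derive t 1 H (K t).
  move=> lot.
  have [] := @continuous_FTC1_closed R K lo t (t + 1) _ _ lot (cK t).
  - by rewrite ltrDl.
  - apply: continuous_compact_integrable; first exact: segment_compact.
    exact: continuous_subspaceT.
  - by move=> dHt dHE; split; [exact: dHt|rewrite -derive1E].
exists H, P; split.
- by move=> r; rewrite P0 PT.
- by move=> r /dH[+ _]; rewrite derivable1_diffP => /differentiable_continuous; exact.
- move=> r s lor los.
  have := @le_increment_of_derive R H K lo (K r) 0 r s dH lor los.
  rewrite !mul0r addr0; apply => t _; rewrite mul0r subr0.
  have [rt|tr] := leP r t; first by rewrite mulr_ge0// subr_ge0// Kle.
  by rewrite mulr_le0// subr_le0 ?(ltW tr)// Kle// ltW.
- move=> g e g' r e0 g'0 g'g lor ar ra rG.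
  (* To the left of [r], [P^4] grows by at most [4 b] per unit length; within [d] this keeps
     [g' * P t ^+ 4] below [g * P r ^+ 4]. *)
  pose d := Num.min e ((g - g') * P r ^+ 4 / (4 * b * g' + 1)).
  have gg0 : 0 < 4 * b * g' + 1 by rewrite ltr_wpDl// !mulr_ge0.
  have d0 : 0 < d by rewrite lt_min e0 !mulr_gt0 ?subr_gt0 ?invr_gt0 ?exprn_gt0.
  near=> s; apply: (@le_increment_of_derive R H K lo) => //.
    by near: s; exact: lt_nbhsr.
  have rsd : `|r - s| < d by near: s; exact: nbhsx_ballx.
  move=> t /andP[t1 t2].
  have rtd : `|r - t| < d.
    apply: le_lt_trans rsd; move: t1 t2; have [rs|sr] := leP r s => t1 t2.
      by rewrite distrC (distrC r) !ger0_norm ?subr_ge0 ?(ltW t1)// lerB// ltW.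
    by rewrite !ger0_norm ?subr_ge0 ?(ltW t2) ?(ltW sr)// lerB// ltW.
  have [rte tlt] : `|r - t| < e /\
      `|r - t| * (4 * b * g' + 1) < (g - g') * P r ^+ 4.
    by move: rtd; rewrite lt_min ltr_pdivlMr// => /andP[].
  have gG u : Num.min r t <= u <= Num.max r t -> g <= G u.
    move=> /andP[u1 u2]; apply: rG; apply: le_lt_trans rte.
    move: u1 u2; have [rt|tr] := leP r t => u1 u2.
      by rewrite distrC (distrC r) !ger0_norm ?subr_ge0// lerB.
    by rewrite !ger0_norm ?subr_ge0 ?(ltW tr)// lerB.
  have frac x y : 0 < x -> 0 <= y -> g' * x <= g * P r ^+ 5 ->
      g' / P r ^+ 5 * y <= g * y / x.
    move=> x0 y0 gx; rewrite ler_pdivlMr//.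
    have -> : g' / P r ^+ 5 * y * x = g' * x * y / P r ^+ 5 by ring.
    rewrite ler_pdivrMr ?exprn_gt0// [leRHS]mulrAC.
    by rewrite ler_wpM2r.
  move: rte; rewrite ltr_norml => /andP[rte1 rte2].
  (* On the right [P t <= P r] and [g' < g] suffice; on the left [P t] is the larger value and the
     choice of [d] enters. *)
  have [rt|tr] := leP r t.
    rewrite mulr_ge0 ?subr_ge0//.
    have h : g * (t - r) <= F t - F r.
      apply: F2 => //; [by lra|by lra|move=> u /andP[ru ut]; apply: gG].
      by rewrite (min_l rt) (max_r rt) (ltW ru) ut.
    apply: le_trans (le_inv_sub _ (P t) (P r) (g * (t - r)) _ _ _) => //.
    + apply: frac; rewrite ?subr_ge0// ?mulr_gt0 ?exprn_gt0//.
      rewrite (exprSr _ 4) ler_pM ?mulr_ge0 ?exprn_ge0 ?(ltW (P0 _)) ?(ltW g'g)//.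
      by rewrite ler_wpM2l ?exprn_ge0 ?(ltW (P0 _))// P_le.
    + exact: P_le.
    + by rewrite !P4; lra.
  rewrite mulr_le0 ?subr_le0 ?(ltW tr)//.
  have h : g * (r - t) <= F r - F t.
    apply: F2 => //; [by lra|by rewrite ltW|by lra|move=> u /andP[ru ut]; apply: gG].
    by rewrite (min_r (ltW tr)) (max_l (ltW tr)) (ltW ru) ut.
  have h' : g' / P r ^+ 5 * (r - t) <= K r - K t.
    apply: le_trans (le_inv_sub _ (P r) (P t) (g * (r - t)) _ _ _) => //.
    + apply: frac; rewrite ?subr_ge0 ?(ltW tr)// ?mulr_gt0 ?exprn_gt0//.
      rewrite (exprSr _ 4) (mulrA g') (mulrA g) ler_wpM2r ?(ltW (P0 _))//.
      have /andP[_ Frt] := F1 _ _ (ltW tr).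
      move: tlt; rewrite gtr0_norm ?subr_gt0// => tlt.
      have h1 : g' * (F r - F t) <= g' * (b * (r - t)) by rewrite ler_wpM2l.
      have -> : P t ^+ 4 = P r ^+ 4 + 4 * (F r - F t) by rewrite !P4; ring.
      lra.
    + by apply: P_le; exact: ltW.
    + by rewrite !P4; lra.
  by rewrite -/(K r); lra.
Unshelve. all: by end_near. Qed.

(** Solving for [r] gives [r <= s - a s^2 + O(s^3)] near 0, and lowering [a] to [b] absorbs the
    error on the stated range of [s]. A quadratic lower bound on [H] thus becomes a quadratic upper
    bound on [u]. *)
Lemma quadratic_inverse_bound (R : realType) (a b r s : R) :
  0 <= b -> b < a -> `|s| * (2 * a * b) <= a - b -> r + a * r ^+ 2 <= s ->
  r + b * s ^+ 2 <= s.
Proof.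
move=> b0 ba sab rs; have a0 : 0 < a by lra.
have [bs|bs] := leP (b * s ^+ 2) (a * r ^+ 2); first lra.
have [s0|s0] := leP s 0.
  have r2 : 0 <= a * r ^+ 2 by rewrite mulr_ge0 ?sqr_ge0// ltW.
  have : s ^+ 2 <= r ^+ 2 by nra.
  by have := sqr_ge0 s; nra.
rewrite gtr0_norm// in sab.
(* [t = (a + b) / 2 a] satisfies [t < 1] and, by AM-GM, [b <= a t^2], so that
   [r <= t s]. *)
have rs' : 2 * a * r <= (a + b) * s.
  rewrite leNgt; apply/negP => h.
  have : ((a + b) * s) ^+ 2 < (2 * a * r) ^+ 2.
    by rewrite ltrXn2r// ?nnegrE; nra.
  have -> : (2 * a * r) ^+ 2 = 4 * a * (a * r ^+ 2) by ring.
  have : 4 * a * (a * r ^+ 2) < 4 * a * (b * s ^+ 2) by rewrite ltr_pM2l; lra.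
  have : 0 <= (a - b) ^+ 2 * s ^+ 2 by rewrite mulr_ge0 ?sqr_ge0.
  lra.
rewrite -(@ler_pM2l _ (2 * a)); last lra.
have : s * (s * (2 * a * b)) <= s * (a - b) by rewrite ler_wpM2l// ltW.
lra.
Qed.

Lemma lt_expr4_left (R : realType) (t l : R) : 0 < t -> l < t ^+ 4 / 4 ->
  exists2 s, 0 < s < t & l < s ^+ 4 / 4.
Proof.
move=> t0 lt.
have : \forall s \near t^'-, l < s ^+ 4 / 4.
  have c4 : (fun s : R => s ^+ 4 / 4) @ t^'- --> t ^+ 4 / 4.
    apply: cvg_at_left_filter; apply: cvgM; last exact: cvg_cst.
    exact: exprn_continuous.
  exact: (cvgr_gt _ c4).
move=> h; near t^'- => s; exists s; last by near: s.
apply/andP; split; first by near: s; exact: nbhs_left_gt.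
by near: s; exact: nbhs_left_lt.
Unshelve. all: by end_near. Qed.

(** * Coordinates, norms and diameter *)

Lemma abs_coord_le_norm (R : realType) (n : nat) (x : 'rV[R]_n) i :
  `|x 0 i| <= `|x|.
Proof.
by rewrite [leRHS]/Num.norm/= mx_normrE; apply/bigmax_geP; right; exists (0, i).
Qed.

Lemma abs_coord_le_enorm (R : realType) (n : nat) (x : 'rV[R]_n) i :
  `|x 0 i| <= enorm x.
Proof.
rewrite /enorm -sqrtr_sqr ler_sqrt; last first.
  by apply: sumr_ge0 => j _; rewrite -expr2 sqr_ge0.
by rewrite /inner (bigD1 i)//= expr2 lerDl sumr_ge0// => j _; rewrite -expr2 sqr_ge0.
Qed.

Lemma abs_coord_le_diam (R : realType) (n : nat) (A : set 'rV[R]_n) i x y :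
  bounded_set A -> A x -> A y -> `|x 0 i - y 0 i| <= diam A.
Proof.
move=> [M [_ AM]] Ax Ay.
have -> : x 0 i - y 0 i = (x - y) 0 i by rewrite !mxE.
apply: le_trans (abs_coord_le_enorm _ _ _ _) _.
apply: ub_le_sup; last by exists x => //; exists y.
have AM1 z j : A z -> `|z 0 j| <= M + 1.
  move=> Az; apply: le_trans (AM (M + 1) _ _ Az); last by rewrite ltrDl.
  exact: abs_coord_le_norm.
exists (Num.sqrt (\sum_(j < n) (2 * (M + 1)) ^+ 2)) => _ [a Aa [b Ab <-]].
rewrite ler_sqrt ?sumr_ge0//; last by move=> j _; rewrite sqr_ge0.
apply: ler_sum => j _; rewrite -expr2 !mxE -real_normK ?num_real//.
have ab := ler_normB (a 0 j) (b 0 j); have aM := AM1 _ j Aa; have bM := AM1 _ j Ab.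
have ab0 := normr_ge0 (a 0 j - b 0 j).
by rewrite lerXn2r// ?nnegrE; lra.
Qed.

Lemma closure_abs_coord_le_diam (R : realType) (n : nat) (A : set 'rV[R]_n) i x y :
  bounded_set A -> closure A x -> closure A y -> `|x 0 i - y 0 i| <= diam A.
Proof.
move=> bA cx cy; apply/ler_addgt0Pr => e e0.
have approx z : closure A z -> exists2 z', A z' & `|z 0 i - z' 0 i| < e / 2.
  move=> /(_ (ball z (e / 2)))[|z' [Az' zz']]; first by apply: nbhsx_ballx; lra.
  exists z' => //; move: zz'; rewrite -ball_normE/=; apply: le_lt_trans.
  by have := abs_coord_le_norm _ _ (z - z') i; rewrite !mxE.
have [x' Ax' xx'] := approx _ cx; have [y' Ay' yy'] := approx _ cy.
have := abs_coord_le_diam _ _ _ i _ _ bA Ax' Ay'.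
have := ler_distD (x' 0 i) (x 0 i) (y 0 i).
have := ler_distD (y' 0 i) (x' 0 i) (y 0 i).
by rewrite (distrC (y' 0 i)); lra.
Qed.

Lemma diam_gt0 (R : realType) (n : nat) (A : set 'rV[R]_n) (i : 'I_n) x :
  open A -> bounded_set A -> A x -> 0 < diam A.
Proof.
move=> oA bA Ax.
have cvgx : x + t *: delta_mx 0 i @[t --> (0 : R)^'+] --> x.
  rewrite -[X in _ --> X]addr0 -[X in _ + X](scale0r (delta_mx 0 i)).
  apply: cvg_at_right_filter; apply: cvgD; first exact: cvg_cst.
  by apply: cvgZr_tmp.
have At : \forall t \near (0 : R)^'+, A (x + t *: delta_mx 0 i).
  by apply: cvgx; exact: open_nbhs_nbhs.
near (0 : R)^'+ => t; have t0 : 0 < t by near: t; exact: nbhs_right_gt.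
apply: lt_le_trans t0 _.
have Axt : A (x + t *: delta_mx 0 i) by near: t.
have := abs_coord_le_diam _ _ _ i _ _ bA Axt Ax.
rewrite !mxE !eqxx mulr1 addrAC subrr add0r; apply: le_trans; exact: ler_norm.
Unshelve. all: by end_near. Qed.

(** * Contact points and compactness of the set of slopes *)

Lemma within_continuous_dist (R : realType) (X : topologicalType) (E : set X)
    (f : X -> R) :
  (forall x e, E x -> 0 < e -> \forall y \near x, E y -> `|f x - f y| < e) ->
  {within E, continuous f}.
Proof.
move=> fE; apply/subspace_continuousP => x Ex; apply/cvgrPdist_lt => e e0.
by rewrite near_withinE; exact: fE.
Qed.

Lemma nnsup_le_ereal (R : realType) (X : Type) (phi : X -> R) (A : set X)
    (s : \bar R) :
  (0 <= s)%E -> (forall x, A x -> ((phi x)%:E <= s)%E) ->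
  ((nnsup phi A)%:E <= s)%E.
Proof.
case: s => [s| |//]; last by move=> _ _; rewrite leey.
rewrite lee_fin => s0 As; rewrite lee_fin; exact: nnsup_le.
Qed.

(** The bound is an affine majorant with value [w x] at [x], and every affine majorant is at least
    [w x] there. *)
Lemma mem_contact_set (R : realType) (n : nat) (Omega : set 'rV[R]_n)
    (w : 'rV[R]_n -> R) (i : 'I_n) (t : R) x :
  Omega x -> (forall y, Omega y -> w y <= w x + t * (y 0 i - x 0 i)) ->
  contact_set Omega w x.
Proof.
move=> Ox wx; split=> //; rewrite /concave_envelope; set S := image _ _.
have Sx : S (w x).
  exists (fun y => w x + t * (y 0 i - x 0 i)); last by rewrite subrr mulr0 addr0.
  split=> //; exists (t *: delta_mx 0 i), (w x - t * x 0 i) => y.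
  rewrite /inner (bigD1 i)//= big1 => [|j ji].
    by rewrite !mxE !eqxx/= mulr1; ring.
  by rewrite !mxE (negbTE ji) andbF mulr0 mul0r.
have lbS : lbound S (w x) by move=> _ [L [_ wL] <-]; exact: wL.
apply/eqP; rewrite eq_le lb_le_inf//=; last by exists (w x).
by apply: ge_inf => //; exists (w x).
Qed.

Lemma within_continuous_near_fst (R : realType) (X Y : topologicalType)
    (K : set X) (f : X -> R) x (t : Y) e : {within K, continuous f} ->
  K x -> 0 < e -> \forall p \near (x, t), K p.1 -> `|f x - f p.1| < e.
Proof.
move=> cf Kx e0; exists ([set y | K y -> `|f x - f y| < e], setT) => /=.
  by split; [exact: (within_continuous_near _ _ _ _ _ _ cf Kx e0)|exact: filterT].
by move=> -[y s] /= [].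
Qed.

(** Recording the slope of the touching affine function along with the contact point, and confining
    it to [[0, T]], reduces compactness to the closedness of two conditions on the pair. *)
Definition slope_set {R : realType} {n : nat} (i : 'I_n) (K : set 'rV[R]_n)
    (u : 'rV[R]_n -> R) (m T : R) : set ('rV[R]_n * R) :=
  (K `*` `[0, T]) `&` [set p | m <= u p.1 /\
    forall y, K y -> u y <= u p.1 + p.2 * (y 0 i - p.1 0 i)].

Lemma compact_slope_set (R : realType) (n : nat) (i : 'I_n) (K : set 'rV[R]_n)
    (u : 'rV[R]_n -> R) (m T : R) :
  compact K -> {within K, continuous u} -> compact (slope_set i K u m T).
Proof.
move=> cK cu; apply: compact_rel_closed.
  by apply: compact_setX => //; exact: segment_compact.
move=> [x t] [/= Kx _] /not_andP[/negP|].
- rewrite -ltNge => uxm.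
  have := within_continuous_near_fst _ _ _ _ _ _ t (m - u x) cu Kx.
  rewrite subr_gt0 => /(_ uxm).
  apply: filterS => -[x' t'] /= xx' [/xx' + _] [mu _].
  by rewrite ltr_norml; lra.
- move=> /existsNP[y /not_implyP[Ky /negP]]; rewrite -ltNge => uy.
  (* [e] measures the violation at [y]: half of it may be lost in [u], half in the linear term. *)
  set e := u y - (u x + t * (y 0 i - x 0 i)).
  have e0 : 0 < e / 2 by rewrite /e; lra.
  have cl : (fun p : 'rV[R]_n * R => p.2 * (y 0 i - p.1 0 i)) @ (x, t) -->
      t * (y 0 i - x 0 i).
    apply: cvgM; first exact: cvg_snd.
    apply: cvgB; first exact: cvg_cst.
    have cx := @coord_continuous R 1 n 0 i x.
    exact: (cvg_comp _ _ (@cvg_fst _ _ (nbhs x) (nbhs t) _) cx).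
  have := within_continuous_near_fst _ _ _ _ _ _ t _ cu Kx e0.
  have /cvgrPdist_lt/(_ _ e0) := cl.
  apply: filterS2 => -[x' t'] /= ll xx' [/xx' + _] [_ /(_ _ Ky)].
  by move: ll; rewrite !ltr_norml /e; lra.
Qed.

Lemma compact_closure_bounded (R : realType) (n : nat) (A : set 'rV[R]_n) :
  bounded_set A -> compact (closure A).
Proof.
move=> [M [_ AM]]; apply: bounded_closed_compact; last exact: closed_closure.
exists (M + 2); split; first exact: num_real.
move=> N MN x /(_ (ball x 1))[|y [Ay]]; first exact: nbhsx_ballx.
rewrite -ball_normE/= => xy.
have yM : `|y| <= M + 1 by apply: AM Ay; rewrite ltrDl.
have := ler_normD (x - y) y; rewrite subrK; lra.
Qed.

Lemma abs_funrposB_le (R : realType) (X : Type) (f : X -> R) x y :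
  `|f^\+ x - f^\+ y| <= `|f x - f y|.
Proof.
rewrite /funrpos; have [h1|h1] := leP (f x) 0; have [h2|h2] := leP (f y) 0.
- by rewrite subrr normr0.
- by rewrite sub0r normrN gtr0_norm// distrC ger0_norm; lra.
- by rewrite subr0 gtr0_norm// ger0_norm; lra.
- by [].
Qed.

(** * Comparison of the function with the profile *)

(** Here [m] is the level [max u - T d], and points of the closure at or above it lie in [Omega].
    The hypothesis on quadratics is the viscosity inequality tested by polynomials in [x_i]. The
    interval extends [[m, max u]] by 1 at both ends to leave room for a window around each of these
    levels. *)
Lemma expr4_le_integral_slopes (R : realType) (n : nat) (i : 'I_n)
    (Omega : set 'rV[R]_n) (f u : 'rV[R]_n -> R) (m T : R) xmax :
  m = u xmax - T * diam Omega -> open Omega -> bounded_set Omega ->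
  {within Omega, continuous f} -> {within closure Omega, continuous u} ->
  (forall y p k, Omega y ->
    (\forall x \near y, Omega x ->
      u x <= u y + p * (x 0 i - y 0 i) - k * (x 0 i - y 0 i) ^+ 2) ->
    2 * k * p ^+ 2 <= f y) ->
  closure Omega xmax -> (forall x, closure Omega x -> u x <= u xmax) ->
  (forall x, closure Omega x -> m <= u x -> Omega x) ->
  0 < T ->
  ((T ^+ 4 / 4)%:E <= \int[lebesgue_measure]_(r in `[(m - 1)%R, (u xmax + 1)%R])
    (nnsup (f^\+ \o fst) (slope_set i (closure Omega) u m T `&`
       [set p | u p.1 = r]))%:E)%E.
Proof.
move=> mE oO bO cf cu hq cxmax uxmax Om T0; rewrite leNgt; apply/negP => ITx.

have cK : compact (closure Omega) by exact: compact_closure_bounded.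
set E := slope_set _ _ _ _ _ in ITx.
have cE : compact E by exact: compact_slope_set.
have EO p : E p -> Omega p.1.
  by move=> [[/= Kp _] [mp _]]; exact: Om.
have cuE : {within E, continuous (u \o fst)}.
  apply: within_continuous_dist => -[x t] e [[/= Kx _] _] e0.
  have := within_continuous_near_fst _ _ _ _ _ _ t _ cu Kx e0.
  by apply: filterS => -[x' t'] /= + [[/= Kx' _] _]; exact.
(* [f] is continuous inside [Omega] only, and [E] lies over [Omega] by [EO]. *)
have cfE : {within E, continuous (f^\+ \o fst)}.
  apply: within_continuous_dist => -[x t] e Ext e0.
  have := within_continuous_near_fst _ _ _ _ _ _ t _ cf (EO _ Ext) e0.
  apply: filterS => -[x' t'] /= + /EO Ox'; move=> /(_ Ox').
  by apply: le_lt_trans; exact: abs_funrposB_le.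
have [b Eb] : exists b, forall p, E p -> (f^\+ \o fst) p <= b.
  have [E0|/set0P/negP] := pselect (E !=set0); last first.
    rewrite negbK => /eqP E0; exists 0 => p; rewrite E0; exact: False_ind.
  have [p _ Ep] := compact_EVT_max E0 cE cfE.
  by exists ((f^\+ \o fst) p) => q Eq; apply: Ep; rewrite inE.
have d0 : 0 <= diam Omega.
  have := closure_abs_coord_le_diam _ _ _ i _ _ bO cxmax cxmax.
  by rewrite subrr normr0.
have mm : m - 1 < u xmax + 1.
  by have : 0 <= T * diam Omega; [rewrite mulr_ge0// ltW|rewrite mE; lra].
have [G [mG [B GB] GT EG]] := nnsup_level_majorant _ _ _ _ _ _ _ _ _ cE cuE cfE Eb mm ITx.
have [lo ulo] : exists lo, forall x, closure Omega x -> lo < u x.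
  have K0 : closure Omega !=set0 by exists xmax.
  have [x _ xmin] := compact_EVT_min K0 cK cu.
  exists (u x - 1) => y Ky; apply: lt_le_trans (xmin y _); last by rewrite inE.
  by rewrite ltrBlDr ltrDl.
have [H [P [PT cH H1 H2]]] := convex_profile _ _ _ _ _ _ lo T0 mG GB GT.
have [y Ky ymax] : exists2 y, closure Omega y & forall x, closure Omega x ->
    H (u x) - x 0 i <= H (u y) - y 0 i.
  have K0 : closure Omega !=set0 by exists xmax.
  have [|y Ky ymax] := compact_EVT_max K0 cK (f := fun x => H (u x) - x 0 i).
  - apply/subspace_continuousP => x Kx; apply: cvgB.
      have cux : u z @[z --> within (closure Omega) (nbhs x)] --> u x.
        by move/subspace_continuousP : (cu) => /(_ x Kx).
      exact: (cvg_comp _ _ cux (cH (u x) (ulo x Kx))).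
    by apply: cvg_within_filter; exact: coord_continuous.
  - exists y; first by rewrite inE in Ky.
    by move=> x Kx; apply: ymax; rewrite inE.
have P0 : 0 < P (u y) by have /andP[] := PT (u y).
(* [H] increases at rate at least [1 / T], while maximality of [y] bounds its increase from [u y] to
   [u xmax] by a coordinate difference, at most the diameter. *)
have my : m <= u y.
  have h1 := H1 _ _ (ulo _ Ky) (ulo _ cxmax).
  have h2 := ymax _ cxmax.
  have := closure_abs_coord_le_diam _ _ _ i _ _ bO cxmax Ky.
  rewrite ler_norml => /andP[_ h3].
  have h4 : T^-1 * (u xmax - u y) <= (P (u y))^-1 * (u xmax - u y).
    rewrite ler_wpM2r ?subr_ge0 ?uxmax// lef_pV2 ?posrE//.
    by have /andP[] := PT (u y).
  have h5 : T^-1 * (u xmax - u y) <= diam Omega by lra.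
  by move: h5; rewrite mulrC ler_pdivrMr// mE; lra.
(* The supporting line of [H] at [u y], inverted, is the touching affine function. *)
have uy x : closure Omega x -> u x <= u y + P (u y) * (x 0 i - y 0 i).
  move=> Kx; have h1 := H1 _ _ (ulo _ Ky) (ulo _ Kx); have h2 := ymax _ Kx.
  have : (P (u y))^-1 * (u x - u y) <= x 0 i - y 0 i by lra.
  by rewrite mulrC ler_pdivrMr//; lra.
have Ey : E (y, P (u y)).
  by split; split=> //=; rewrite in_itv/= (ltW P0); have /andP[] := PT (u y).
have [e1 e10 eG] := EG _ Ey.
have Oy : Omega y by exact: Om.
set F := (f^\+)%R y; have F0 : 0 <= F by exact: funrpos_ge0.
have fF : f y <= F by rewrite /F /funrpos le_max lexx.
pose e := Num.min e1 1; have e0 : 0 < e by rewrite lt_min e10/=.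
have ee1 : e <= e1 by rewrite ge_min lexx.
have e1' : e <= 1 by rewrite ge_min lexx orbT.
(* The margin [e1] is spent in steps: [G] is at least [F + e1] near [u y], the growth of [H] retains
   [F + e1 / 2], and the bound on [u] retains [F + e1 / 4], still more than [f y]. *)
have := H2 (F + e1) e (F + e1 / 2) (u y) e0 ltac:(lra) ltac:(lra) (ulo _ Ky).
have uyM := uxmax _ Ky.
move=> /(_ ltac:(lra) ltac:(lra)) /(_ (fun t yt => eG t (lt_le_trans yt ee1))) near1.
(* Dividing [u x - u y] by [P (u y)] turns the [P^5] of the profile into [P^3]. *)
pose a := (F + e1 / 2) / (2 * P (u y) ^+ 3).
pose b1 := (F + e1 / 4) / (2 * P (u y) ^+ 3).
have P3 : 0 < 2 * P (u y) ^+ 3 by rewrite mulr_gt0// exprn_gt0.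
have b10 : 0 <= b1 by rewrite divr_ge0 ?(ltW P3)//; lra.
have ba : b1 < a by rewrite ltr_pM2r ?invr_gt0//; lra.
suff : 2 * (P (u y) * b1) * (P (u y)) ^+ 2 <= f y.
  have -> : 2 * (P (u y) * b1) * (P (u y)) ^+ 2 = F + e1 / 4.
    by rewrite /b1; field; rewrite gt_eqF.
  lra.
apply: hq => //.
have /nbhs_ballP[r0 /= r00 near_u] := near1.
have a0 : 0 <= a by exact: le_trans b10 (ltW ba).
have ab0 : 0 < 2 * a * b1 + 1 by rewrite ltr_wpDl// mulr_ge0// mulr_ge0.
have cy : (fun z : 'rV[R]_n => z 0 i) @ y --> y 0 i by exact: coord_continuous.
have r10 : 0 < (a - b1) / (2 * a * b1 + 1) by rewrite divr_gt0// subr_gt0.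
near=> x; move=> Ox; have Kx : closure Omega x by exact: subset_closure.
have uxy : `|u y - u x| < r0.
  by move: Kx; near: x; exact: (within_continuous_near _ _ _ _ _ _ cu Ky r00).
have xyi : `|y 0 i - x 0 i| < (a - b1) / (2 * a * b1 + 1).
  by near: x; have /cvgrPdist_lt := cy; exact.
have hx : H (u x) - H (u y) <= x 0 i - y 0 i by have := ymax _ Kx; lra.
have {}near_u := near_u (u x) uxy.
pose w := (u x - u y) / P (u y).
have : w + b1 * (x 0 i - y 0 i) ^+ 2 <= x 0 i - y 0 i.
  apply: (quadratic_inverse_bound _ a) => //.
    move: xyi; rewrite ltr_pdivlMr// distrC.
    by have := normr_ge0 (x 0 i - y 0 i); lra.
  have -> : w + a * w ^+ 2 = (P (u y))^-1 * (u x - u y) +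
      (F + e1 / 2) / P (u y) ^+ 5 / 2 * (u x - u y) ^+ 2.
    by rewrite /w /a; field; rewrite gt_eqF.
  exact: le_trans hx.
move=> h; rewrite -(ler_pM2l P0) in h.
have : P (u y) * w = u x - u y by rewrite /w mulrC divfK// gt_eqF.
by lra.
Unshelve. all: by end_near. Qed.

(** * Quadratic test functions of one coordinate *)

Lemma is_derive_coord (R : realType) (n : nat) (i : 'I_n) (x v : 'rV[R]_n) :
  is_derive x v (fun z : 'rV[R]_n => z 0 i) (v 0 i).
Proof.
have cst_quotient : (fun h : R => h^-1 *: ((h *: v + x) 0 i - x 0 i)) @ 0^' -->
    v 0 i.
  apply: cvg_near_cst; near=> h.
  rewrite !mxE addrK /GRing.scale/= mulKf//; near: h.
  exact: nbhs_dnbhs_neq.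
apply: DeriveDef; first by apply/cvg_ex; exists (v 0 i).
exact: cvg_lim.
Unshelve. all: by end_near. Qed.

Definition quadratic_test {R : realType} {n : nat} (i : 'I_n) (y : 'rV[R]_n)
    (p k : R) (x : 'rV[R]_n) : R :=
  p * (x 0 i - y 0 i) - k * (x 0 i - y 0 i) ^+ 2.

Section quadratic_test.
Context {R : realType} {n : nat}.
Variables (i : 'I_n) (y : 'rV[R]_n).

Lemma is_derive_quadratic_test (p k : R) (x v : 'rV[R]_n) :
  is_derive x v (quadratic_test i y p k) ((p - 2 * k * (x 0 i - y 0 i)) * v 0 i).
Proof.
pose q : 'rV[R]_n -> R := (fun z : 'rV[R]_n => z 0 i) - cst (y 0 i).
have dq : is_derive x v q (v 0 i).
  have dx := is_derive_coord _ _ i x v.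
  by rewrite /q; apply: is_derive_eq; rewrite subr0.
have -> : quadratic_test i y p k = (p \*: q) - (k \*: (q ^+ 2)) by [].
apply: is_derive_eq; rewrite /GRing.scale/=.
have -> : q x = x 0 i - y 0 i by [].
by ring.
Qed.

(** Written as a test function with [k = 0] plus a constant, the first derivative can be
    differentiated again by the same rule. *)
Lemma partial_quadratic_test (p k : R) j :
  partial j (quadratic_test i y p k) =
  quadratic_test i y (- 2 * k * (j == i)%:R) 0 \+ cst (p * (j == i)%:R).
Proof.
apply/funext => x; rewrite /partial.
have /@derive_val -> := is_derive_quadratic_test p k x (delta_mx 0 j).
by rewrite mxE eqxx eq_sym /quadratic_test/=; ring.
Qed.

Lemma partial2_quadratic_test (p k : R) j l x :
  partial l (partial j (quadratic_test i y p k)) x =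
  - 2 * k * (j == i)%:R * (l == i)%:R.
Proof.
rewrite partial_quadratic_test /partial.
have -> : quadratic_test i y (- 2 * k * (j == i)%:R) 0 \+ cst (p * (j == i)%:R) =
  quadratic_test i y (- 2 * k * (j == i)%:R) 0 + cst (p * (j == i)%:R) by [].
have d1 := is_derive_quadratic_test (- 2 * k * (j == i)%:R) 0 x (delta_mx 0 l).
have /@derive_val -> := is_deriveD d1 (is_derive_cst (p * (j == i)%:R) x (delta_mx 0 l)).
by rewrite mxE eqxx/= (eq_sym l) addr0 mulr0 mul0r subr0.
Qed.

Lemma C2_quadratic_test (p k : R) (Omega : set 'rV[R]_n) :
  C2 Omega (quadratic_test i y p k).
Proof.
have dQ a b x v : derivable (quadratic_test i y a b) x v.
  by have [] := is_derive_quadratic_test a b x v.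
have cQ a b : continuous (quadratic_test i y a b).
  move=> x; have cx : (fun z : 'rV[R]_n => z 0 i - y 0 i) @ x --> x 0 i - y 0 i.
    exact: (cvgB (@coord_continuous R 1 n 0 i x) (cvg_cst _)).
  exact: (cvgB (cvgM (cvg_cst _) cx) (cvgM (cvg_cst _) (cvgM cx cx))).
have dQD a b c x v : derivable (quadratic_test i y a b \+ cst c) x v.
  by apply: derivableD.
have cQD a b c : continuous (quadratic_test i y a b \+ cst c).
  by move=> x; exact: (cvgD (cQ a b x) (cvg_cst c)).
split=> [j|l j]; split.
- by move=> x _; exact: dQ.
- by rewrite partial_quadratic_test; exact: continuous_subspaceT.
- by move=> x _; rewrite partial_quadratic_test; exact: dQD.
- have -> : partial j (partial l (quadratic_test i y p k)) =
      cst (- 2 * k * (l == i)%:R * (j == i)%:R).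
    by apply/funext => x; rewrite partial2_quadratic_test.
  by move=> x; exact: cvg_cst.
Qed.

Lemma inf_laplacian_quadratic_test (p k : R) :
  inf_laplacian (quadratic_test i y p k) y = - (2 * k * p ^+ 2).
Proof.
have gE : gradient (quadratic_test i y p k) y = p *: delta_mx 0 i.
  apply/rowP => j; rewrite !mxE partial_quadratic_test /quadratic_test/=.
  by rewrite subrr; ring.
rewrite /inf_laplacian gE /inner (bigD1 i)//= big1 => [|j ji]; last first.
  by rewrite [X in _ * X]mxE [X in _ * (_ * X)]mxE (negbTE ji) andbF !mulr0.
rewrite addr0 !mxE (bigD1 i)//= big1 => [|j ji]; last first.
  by rewrite !mxE (negbTE ji) andbF mulr0 mul0r.
by rewrite !mxE partial2_quadratic_test !eqxx/=; ring.
Qed.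

End quadratic_test.

(** * The estimate for positive and negative parts *)

(** The hypothesis on quadratics is the form in which both viscosity conditions enter, for [u] and
    for [- u]. If the estimate failed, the integral would be below [T^4 / 4] for some
    [T < (M - mb) / d], against the lower bound by slopes. *)
Lemma expr4_estimate (R : realType) (n : nat) (i : 'I_n)
    (Omega : set 'rV[R]_n) (f u : 'rV[R]_n -> R) :
  open Omega -> bounded_set Omega ->
  {within Omega, continuous f} -> {within closure Omega, continuous u} ->
  (forall y p k, Omega y ->
    (\forall x \near y, Omega x ->
      u x <= u y + p * (x 0 i - y 0 i) - k * (x 0 i - y 0 i) ^+ 2) ->
    2 * k * p ^+ 2 <= f y) ->
  (((sup (u^\+ @` Omega) - sup (u^\+ @` boundary Omega)) ^+ 4)%R%:E <=
    (4 * diam Omega ^+ 4)%R%:E *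
    \int[lebesgue_measure]_(r in `[(sup (u^\+ @` boundary Omega))%R,
                                   (sup (u^\+ @` Omega))%R])
      sup_norm_on [set x | Omega x /\ (u^\+)%R x = r]
        (f^\+ \* \1_(contact_set Omega u))%R)%E.
Proof.
move=> oO bO cf cu hq.
set mb := sup (u^\+ @` boundary Omega); set M := sup (u^\+ @` Omega).
set g := fun r : R => sup_norm_on _ _.
have g0 r : (0 <= g r)%E by apply: ereal_sup_ubound; left.
have I0 : (0 <= \int[lebesgue_measure]_(r in `[mb, M]) g r)%E.
  by apply: integral_ge0 => r _; exact: g0.
have cK : compact (closure Omega) by exact: compact_closure_bounded.
(* For empty [Omega] both real suprema take the default value 0 and the left side vanishes. *)
have [Oe|/set0P Oe] := eqVneq Omega set0.
  have -> : M = 0 by rewrite /M Oe image_set0 sup0.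
  have -> : mb = 0 by rewrite /mb /boundary Oe closure0 set0D image_set0 sup0.
  rewrite subrr expr0n; apply: mule_ge0; last by apply: integral_ge0 => r _; exact: g0.
  by rewrite lee_fin mulr_ge0// exprn_even_ge0.
have [x0 Ox0] := Oe.
have K0 : closure Omega !=set0 by exists x0; exact: subset_closure.
have [xmax + xM] := compact_EVT_max K0 cK cu; rewrite inE => cxmax.
have {}xM x : closure Omega x -> u x <= u xmax by move=> Kx; apply: xM; rewrite inE.
have ubK (A : set 'rV[R]_n) : A `<=` closure Omega -> has_ubound (u^\+ @` A).
  move=> AK; exists (u^\+ xmax) => _ [x Ax <-]; rewrite /funrpos.
  by rewrite ge_max !le_max lexx orbT xM//; exact: AK.
have ubO := ubK _ (@subset_closure _ Omega).
have uM x : Omega x -> u^\+ x <= M by move=> Ox; apply: ub_le_sup => //; exists x.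
have M0 : 0 <= M by apply: le_trans (uM _ Ox0); exact: funrpos_ge0.
have uKM x : closure Omega x -> u^\+ x <= M.
  move=> Kx; apply/ler_addgt0Pr => e e0.
  have [y [Oy uxy]] := Kx _ (within_continuous_near _ _ _ _ _ _ cu Kx e0).
  have := abs_funrposB_le _ _ u x y; have := uxy (subset_closure Oy).
  by have := uM _ Oy; rewrite ler_norml => ? ? /andP[]; lra.
have bdub := ubK (boundary Omega) (@subDsetl _ _ _).
have mbM : mb <= M.
  have [B0|/set0P B0] := eqVneq (boundary Omega) set0.
    by rewrite /mb B0 image_set0 sup0.
  apply: ge_sup; first by have [z Bz] := B0; exists (u^\+ z), z.
  by move=> _ [x [Kx _] <-]; exact: uKM.
have mb0 : 0 <= mb.
  have [B0|/set0P [z Bz]] := eqVneq (boundary Omega) set0.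
    by rewrite /mb B0 image_set0 sup0.
  by apply: le_trans (funrpos_ge0 u z) _; apply: ub_le_sup => //; exists z.
have d0 : 0 < diam Omega by exact: (diam_gt0 _ _ _ i x0).
have d40 : 0 < 4 * diam Omega ^+ 4 by rewrite mulr_gt0// exprn_gt0.
have [->|mbM'] := eqVneq mb M.
  rewrite subrr expr0n; apply: mule_ge0; first by rewrite lee_fin ltW.
  by apply: integral_ge0 => r _; exact: g0.
have {mbM mbM'} mbM : mb < M by rewrite lt_neqAle mbM' mbM.
have M0' : 0 < M by exact: le_lt_trans mb0 mbM.
have uxM : u xmax = M.
  apply/eqP; rewrite eq_le; apply/andP; split.
    by apply: le_trans (uKM _ cxmax); rewrite /funrpos le_max lexx.
  have : M <= u^\+ xmax.
    apply: ge_sup; first by exists (u^\+ x0), x0.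
    move=> _ [x Ox <-]; rewrite /funrpos ge_max !le_max lexx orbT xM//.
    exact: subset_closure.
  by rewrite /funrpos le_max => /orP[//|]; rewrite leNgt M0'.
have le_mb x : boundary Omega x -> u x <= mb.
  move=> Bx; apply: le_trans (_ : u^\+ x <= _); first by rewrite /funrpos le_max lexx.
  by apply: ub_le_sup => //; exists x.
rewrite leNgt; apply/negP => Ilt.
(* An infinite integral would make the right side [+oo], the other factor being positive. *)
have [l Il] : exists l : R, (\int[lebesgue_measure]_(r in `[mb, M]) g r = l%:E)%E.
  move: I0 Ilt; case: (integral _ _ _) => [l| |//] _; first by exists l.
  by rewrite gt0_muley ?lte_fin// ltNge leey.
rewrite Il -EFinM lte_fin in Ilt.
have lT : l < ((M - mb) / diam Omega) ^+ 4 / 4.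
  rewrite expr_div_n -mulrA -invfM ltr_pdivlMr; last by rewrite mulrC.
  by move: Ilt; lra.
have T00 : 0 < (M - mb) / diam Omega by rewrite divr_gt0// subr_gt0.
(* A strictly smaller [T] keeps the level [M - T d] above [mb], so points that reach it are not on
   the boundary. *)
have [T /andP[T0 Tlt] {}lT] := lt_expr4_left _ _ _ T00 lT.
have Td : T * diam Omega < M - mb by rewrite -ltr_pdivlMr.
have := expr4_le_integral_slopes _ _ i _ _ _ (u xmax - T * diam Omega) T xmax erefl
  oO bO cf cu hq cxmax xM _ T0.
have OM x : closure Omega x -> u xmax - T * diam Omega <= u x -> Omega x.
  move=> Kx mx; have [//|nOx] := pselect (Omega x).
  have /le_mb : boundary Omega x by split => // /interior_subset.
  by move: mx; rewrite uxM; lra.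
move=> /(_ OM); apply/negP; rewrite -ltNge.
apply: le_lt_trans (_ : (l%:E < _)%E); last by rewrite lte_fin.
rewrite -Il; apply: ge0_le_lower_integral => //.
  by move=> r _; rewrite lee_fin; exact: nnsup_ge0.
move=> r; rewrite !patchE.
case: ifPn => [r1|_]; last by case: ifPn.
(* For [r] in [[mb, M]] one has [r >= 0], so [u^+ = r] at slope points of level [r], and these are
   contact points. For other [r] there are no such points and the supremum is 0. *)
case: ifPn => [_|rM].
  apply: nnsup_le_ereal => // -[x t] [[[/= Kx tT] [mx xt]] uxr].
  have Ox := OM _ Kx mx.
  have ur : (u^\+)%R x = r.
    rewrite /funrpos uxr; apply/max_idPl; rewrite -uxr; apply: le_trans mx.
    by rewrite uxM; lra.
  apply: ereal_sup_ubound; right; exists x; first by split.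
  rewrite /= indicE mem_set ?mulr1 ?ger0_norm//.
  by apply: (mem_contact_set _ _ _ _ i t) => // y Oy; apply: xt; exact: subset_closure.
rewrite lee_fin; apply: nnsup_le => // -[x t] [[[/= Kx tT] [mx xt]] uxr].
exfalso; move/negP: rM; apply; rewrite inE/= in_itv/= -uxr -uxM xM// andbT.
by apply: le_trans mx; rewrite uxM; lra.
Qed.

Theorem theorem3p5 (R : realType) (n : nat) (hn : (2 <= n)%N)
    (Omega : set 'rV[R]_n) (hopen : open Omega) (hbdd : bounded_set Omega)
    (f u : 'rV[R]_n -> R)
    (hf : {within Omega, continuous f})
    (hu : {within closure Omega, continuous u}) :
  (viscosity_subsolution Omega u f ->
    (((sup (u^\+ @` Omega) - sup (u^\+ @` boundary Omega)) ^+ 4)%R%:E <=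
      (4 * diam Omega ^+ 4)%R%:E *
      \int[lebesgue_measure]_(r in `[(sup (u^\+ @` boundary Omega))%R,
                                     (sup (u^\+ @` Omega))%R])
        sup_norm_on [set x | Omega x /\ (u^\+)%R x = r]
          (f^\+ \* \1_(contact_set Omega u))%R)%E) /\
  (viscosity_supersolution Omega u f ->
    (((sup (u^\- @` Omega) - sup (u^\- @` boundary Omega)) ^+ 4)%R%:E <=
      (4 * diam Omega ^+ 4)%R%:E *
      \int[lebesgue_measure]_(r in `[(sup (u^\- @` boundary Omega))%R,
                                     (sup (u^\- @` Omega))%R])
        sup_norm_on [set x | Omega x /\ (u^\-)%R x = r]
          (f^\- \* \1_(contact_set Omega (\- u)))%R)%E).
Proof.
pose i : 'I_n := Ordinal (ltnW hn); split=> [[_ sub]|[_ super]].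
  apply: (expr4_estimate _ _ i) => // y p k Oy touch.
  have := sub y _ Oy (C2_quadratic_test i y p k Omega).
  rewrite inf_laplacian_quadratic_test opprK; apply.
  apply: filterS touch => x /[apply].
  by rewrite /quadratic_test subrr expr0n/= !mulr0; lra.
(* Negative parts are positive parts of [- u] and [- f]; a quadratic touching [- u] from above
   touches [u] from below once its signs are changed. *)
rewrite -(funrposN u) -(funrposN f).
apply: (expr4_estimate _ _ i) => //.
- by move=> x; apply: continuousN; exact: hf.
- by move=> x; apply: continuousN; exact: hu.
move=> y p k Oy touch.
have := super y _ Oy (C2_quadratic_test i y (- p) (- k) Omega).
rewrite inf_laplacian_quadratic_test sqrrN mulrN mulNr !opprK lerNr; apply.
apply: filterS touch => x /[apply].
by rewrite /quadratic_test subrr expr0n/= !mulr0; lra.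
Qed.
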